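(* Let $\mathcal E=(E_1,E_2,E_?)$ be a proper USD measurement of a pair of weighted density operators $\mathcal S=(\gamma_1,\gamma_2)$ on a finite-dimensional complex Hilbert space $\mathscr H$. Let $\Lambda_1$ be the orthogonal projector onto $\ker\gamma_2\cap\operatorname{supp}\mathcal S$ and $\Lambda_2$ the orthogonal projector onto $\ker\gamma_1\cap\operatorname{supp}\mathcal S$. Then $\mathcal E$ is optimal if and only if both of the following hold: $$(\Lambda_1-\Lambda_2)\,E_?(\gamma_2-\gamma_1)E_?\,(\Lambda_1+\Lambda_2)\ge 0,$$ $$(\Lambda_1-\Lambda_2)\,E_?(\gamma_2-\gamma_1)E_?\,(1-E_?)=0.$$ Here ''$\ge 0$'' means that the operator is self-adjoint and positive semi-definite.
   Context: A weighted density operator is a positive semi-definite operator on $\mathscr H$ (no normalization of the trace is required). For a positive semi-definite operator $\rho$, $\operatorname{supp}\rho=(\ker\rho)^\perp$. For $\mathcal S=(\gamma_1,\gamma_2)$ put $\operatorname{supp}\mathcal S=\operatorname{supp}(\gamma_1+\gamma_2)=\operatorname{supp}\gamma_1+\operatorname{supp}\gamma_2$. A USD (unambiguous state discrimination) measurement of $\mathcal S$ is a triple $\mathcal E=(E_1,E_2,E_?)$ of positive semi-definite operators on $\mathscr H$ with $E_1+E_2+E_?=1$ (identity), $\operatorname{tr}(E_2\gamma_1)=0$ and $\operatorname{tr}(E_1\gamma_2)=0$. Its success probability is $P_{\mathrm{succ}}(\mathcal E;\mathcal S)=\operatorname{tr}(E_1\gamma_1)+\operatorname{tr}(E_2\gamma_2)$.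 It is optimal if its success probability is maximal among all USD measurements of $\mathcal S$, and proper if $\operatorname{supp}(E_1+E_2)\subseteq\operatorname{supp}\mathcal S$. *)

(* Defs.v *)
From mathcomp Require Import all_boot all_order all_algebra spectral.

Set Implicit Arguments.
Unset Strict Implicit.
Unset Printing Implicit Defensive.

Import Order.TTheory GRing.Theory Num.Theory Num.Def.
Local Open Scope ring_scope.
Local Open Scope sesquilinear_scope.

(* The Hilbert space is C^n with its standard inner product, and an operator is
   its matrix A : 'M[C]_n acting on column vectors, so that *m is composition of
   operators and A ^t* is the adjoint.  A subspace W of C^n is represented,
   following mxalgebra, by a matrix whose row space consists of the row vectors
   u such that the column u ^t* lies in W; this correspondence is bijective and
   preserves inclusion, intersection, sum and orthogonality. *)

Section Operators.
Context {C : numClosedFieldType} {n : nat}.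
Implicit Types (A : 'M[C]_n) (u : 'rV[C]_n).

Definition psdmx A : Prop :=
  A \is hermsymmx /\ forall v : 'cV[C]_n, 0 <= (v ^t* *m A *m v) 0 0.

(* See sub_kerop: the adjoint is there because rows stand for adjoints of
   columns. *)
Definition kerop A : 'M[C]_n := kermx (A ^t*).

Definition orthocompl (W : 'M[C]_n) : 'M[C]_n :=
  orthomx conjC (mx_of_hermitian (hermitian1mx n)) W.

Definition suppop A : 'M[C]_n := orthocompl (kerop A).

Lemma sub_kerop A u : (u <= kerop A)%MS = (A *m u ^t* == 0).
Proof.
have -> : A *m u ^t* = (u *m A ^t*) ^t*.
  by rewrite trmx_mul map_mxM trmxCK.
by rewrite map_mx_eq0 trmx_eq0; apply/sub_kermxP/eqP.
Qed.

(* The matrix proj_ortho W is characterised in the library by its action on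
   rows; the next two facts make it the orthogonal projector onto W when acting
   on columns. *)
Lemma proj_ortho_herm (W : 'M[C]_n) : (proj_ortho W) ^t* = proj_ortho W.
Proof.
set P := proj_ortho W.
have PQ0 : P *m (1%:M - P) ^t* = 0.
  apply/orthomx1P; apply: submx_trans (_ : (W <= _)%MS).
    by rewrite -[P]mul1mx proj_ortho_sub.
  rewrite orthomx_sym -[X in (_ - X <= _)%MS]mul1mx.
  exact: proj_ortho_compl_sub.
have PPa : P = P *m P ^t*.
  apply/eqP; rewrite -subr_eq0 -PQ0 linearB /= trmx1 map_mxB map_mx1.
  by rewrite mulmxBr mulmx1.
by rewrite [in LHS]PPa trmx_mul map_mxM trmxCK -PPa.
Qed.

Lemma proj_ortho_fix (W : 'M[C]_n) u :
  (u <= W)%MS = (proj_ortho W *m u ^t* == u ^t*).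
Proof.
have -> : proj_ortho W *m u ^t* = (u *m proj_ortho W) ^t*.
  by rewrite trmx_mul map_mxM proj_ortho_herm.
rewrite -subr_eq0 -map_mxB -linearB map_mx_eq0 /= trmx_eq0 subr_eq0.
apply/idP/eqP => [/proj_ortho_id //|<-]; exact: proj_ortho_sub.
Qed.

End Operators.

Section Discrimination.
Context {C : numClosedFieldType} {n : nat}.
Implicit Types g E F Einc Finc : 'M[C]_n.

Definition weighted_density g : Prop := psdmx g.

(* Einc is the inconclusive effect E_? *)
Record usd_measurement g1 g2 E1 E2 Einc : Prop := UsdMeasurement {
  usd_psd1 : psdmx E1;
  usd_psd2 : psdmx E2;
  usd_psdinc : psdmx Einc;
  usd_sum : E1 + E2 + Einc = 1%:M;
  usd_tr21 : \tr (E2 *m g1) = 0;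
  usd_tr12 : \tr (E1 *m g2) = 0 }.

(* For positive semi-definite arguments this is a nonnegative real, and the
   order of C below is then the order of the reals. *)
Definition success_prob g1 g2 E1 E2 : C := \tr (E1 *m g1) + \tr (E2 *m g2).

Definition optimal_usd g1 g2 E1 E2 Einc : Prop :=
  usd_measurement g1 g2 E1 E2 Einc /\
  forall F1 F2 Finc, usd_measurement g1 g2 F1 F2 Finc ->
    success_prob g1 g2 F1 F2 <= success_prob g1 g2 E1 E2.

Definition supp_pair g1 g2 : 'M[C]_n := suppop (g1 + g2).

Definition proper_usd g1 g2 E1 E2 Einc : Prop :=
  usd_measurement g1 g2 E1 E2 Einc /\
  (suppop (E1 + E2) <= supp_pair g1 g2)%MS.

End Discrimination.

(* Main.v *)
(* Write M = E_?(g2 - g1)E_? and L1, L2 for the two projectors.  Since the ranges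
   of L1 and L2 meet only in 0, the two conditions of the theorem split into
   L1 M L2 = 0, L1 M L1 >= 0, L2 M L2 <= 0 and Li M (E1 + E2) = 0.

   Necessity: for k in the range of L1, E_? k = a - b with a = k - E1 k and
   b = E2 k in the ranges of L1 and L2.  Adding a multiple of aa^* to E1 and
   subtracting the same multiple of bb^* from E2 keeps E_? positive up to second
   order, as aa^* - bb^* is the Hermitian part of (a - b)(a + b)^* and a - b is in
   the range of E_?.  The gain is -<k, M k>.  Reversed and polarized, this
   variation gives all the conditions.

   Sufficiency: one builds a dual solution, a Hermitian Z with Z E_? = 0 and
   Li Z Li = Li (gi +- M) Li >= gi on the range of Li.  The conditions say exactly
   that the two prescribed blocks agree modulo the range of E_?.  Z need not be
   positive: it is only positive on two subspaces, but every inconclusive effect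
   F_? is a sum of two positive operators, each supported in one of them, so that
   tr(F_? Z) >= 0 nevertheless. *)

Require Import Defs.
From mathcomp Require Import all_boot all_order all_algebra spectral.
From mathcomp Require Import complex reals ring.

Set Implicit Arguments.
Unset Strict Implicit.

Import Order.TTheory GRing.Theory Num.Theory.
Local Open Scope ring_scope.
Local Open Scope sesquilinear_scope.

Definition opmul (C : numClosedFieldType) m n p
  (A : 'M[C]_(m, n)) (B : 'M[C]_(n, p)) := A *m B.

Lemma opmulE (C : numClosedFieldType) m n p
  (A : 'M[C]_(m, n)) (B : 'M[C]_(n, p)) :
  A *m B = opmul A B.
Proof. by []. Qed.

(* Identities that hold in the free additive group on the matrix products: the
   products are expanded, made opaque, and compared entrywise.  The detour
   through opmul makes convertible products syntactically equal. *)
Ltac mx_ring :=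
  rewrite ?(mulmxDl, mulmxDr, mulmxBl, mulmxBr, mulmxN, mulNmx, mul1mx, mulmx1,
            mul0mx, mulmx0) -?mulmxA ?opmulE;
  repeat match goal with |- context [@opmul ?R ?m ?n ?p ?A ?B] =>
    generalize (@opmul R m n p A B); intro end;
  apply/matrixP => ? ?; rewrite !mxE; ring.

(** * Adjoints and positive semi-definite matrices *)

Section Adjoint.
Context {C : numClosedFieldType}.

Lemma dagM m n p (A : 'M[C]_(m, n)) (B : 'M[C]_(n, p)) :
  (A *m B) ^t* = B ^t* *m A ^t*.
Proof. by rewrite trmx_mul map_mxM. Qed.

Lemma dagD m n (A B : 'M[C]_(m, n)) : (A + B) ^t* = A ^t* + B ^t*.
Proof. by rewrite linearD map_mxD. Qed.

Lemma dagN m n (A : 'M[C]_(m, n)) : (- A) ^t* = - A ^t*.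
Proof. by rewrite linearN map_mxN. Qed.

Lemma dagZ m n a (A : 'M[C]_(m, n)) : (a *: A) ^t* = a^* *: A ^t*.
Proof. by rewrite linearZ map_mxZ. Qed.

Lemma dag0 m n : (0 : 'M[C]_(m, n)) ^t* = 0.
Proof. by rewrite trmx0 map_mx0. Qed.

Lemma dag1 n : (1%:M : 'M[C]_n) ^t* = 1%:M.
Proof. by rewrite trmx1 map_mx1. Qed.

Definition dagE := (dagM, dagD, dagN, dag0, dag1, @trmxCK).

Lemma dag_eq0 m n (A : 'M[C]_(m, n)) : A ^t* = 0 -> A = 0.
Proof. by move=> A0; rewrite -[A]trmxCK A0 dag0. Qed.

Lemma mxtraceN n (A : 'M[C]_n) : \tr (- A) = - \tr A.
Proof. exact: linearN. Qed.

Lemma gram_diagE m n (A : 'M[C]_(m, n)) j :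
  (A ^t* *m A) j j = \sum_i `|A i j| ^+ 2.
Proof.
by rewrite mxE; apply: eq_bigr => i _; rewrite !mxE mulrC -normCK.
Qed.

Lemma tr_gram_ge0 m n (A : 'M[C]_(m, n)) : 0 <= \tr (A ^t* *m A).
Proof.
apply: sumr_ge0 => j _; rewrite gram_diagE.
by apply: sumr_ge0 => i _; rewrite exprn_ge0.
Qed.

Lemma tr_gram_eq0 m n (A : 'M[C]_(m, n)) : \tr (A ^t* *m A) = 0 -> A = 0.
Proof.
move=> tr0; apply/matrixP => i j; rewrite mxE.
have sq_ge0 k l : 0 <= `|A k l| ^+ 2 by rewrite exprn_ge0.
have dj k : true -> 0 <= (A ^t* *m A) k k.
  by move=> _; rewrite gram_diagE; apply: sumr_ge0.
have := psumr_eq0P dj tr0 (i := j) isT; rewrite gram_diagE.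
move=> /(psumr_eq0P (fun k _ => sq_ge0 k j))/(_ i isT)/eqP.
by rewrite expf_eq0 /= normr_eq0 => /eqP.
Qed.

Lemma gram_eq0 m n (A : 'M[C]_(m, n)) : A ^t* *m A = 0 -> A = 0.
Proof. by move=> A0; apply: tr_gram_eq0; rewrite A0 mxtrace0. Qed.

End Adjoint.

Section Psd.
Context {C : numClosedFieldType} {n : nat}.
Implicit Types A B X : 'M[C]_n.

Lemma hermsymP A : reflect (A ^t* = A) (A \is hermsymmx).
Proof.
by apply: (iffP (is_hermitianmxP _ _ _)); rewrite expr0 scale1r.
Qed.

Lemma psd_dag A : psdmx A -> A ^t* = A.
Proof. by case=> /hermsymP. Qed.

Lemma psd_gram m (S : 'M[C]_(m, n)) : psdmx (S ^t* *m S).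
Proof.
split; first by apply/hermsymP; rewrite !dagE.
move=> v; rewrite mulmxA -dagM -mulmxA -[X in 0 <= X]addr0.
by have := tr_gram_ge0 (S *m v); rewrite /mxtrace big_ord1 addr0.
Qed.

Lemma psd_spectral A : psdmx A -> exists (U : 'M[C]_n) (d : 'rV[C]_n),
  [/\ U ^t* *m U = 1%:M, forall i, 0 <= d 0 i & A = U ^t* *m diag_mx d *m U].
Proof.
move=> [hA posA]; set U := spectralmx A; set d := spectral_diag A.
have UU : U *m U ^t* = 1%:M by apply/unitarymxP/spectral_unitarymx.
have defA : A = U ^t* *m diag_mx d *m U.
  rewrite -invmx_unitary ?spectral_unitarymx //.
  exact/orthomx_spectralP/hermitian_normalmx.
exists U, d; split => // [|i]; first exact: mulmx1C.
have := posA (U ^t* *m delta_mx i 0); rewrite {1}defA dagM trmxCK.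
rewrite -!mulmxA (mulmxA U) UU mul1mx (mulmxA U) UU mul1mx.
rewrite mul_diag_mx mxE (bigD1 i) //= big1 ?addr0 => [|j /negPf ji].
  by rewrite !mxE !eqxx /= mulr1 rmorph1 mul1r.
by rewrite !mxE ji mulr0 mulr0.
Qed.

Lemma diag_gram (d : 'rV[C]_n) (S := diag_mx (map_mx sqrtC d)) :
  (forall i, 0 <= d 0 i) -> diag_mx d = S ^t* *m S.
Proof.
move=> d_ge0; rewrite mul_mx_diag; apply/matrixP => i j; rewrite !mxE.
have [->|ne_ij] := eqVneq i j; last by rewrite !mulr0n rmorph0 mul0r.
by rewrite !mulr1n geC0_conj ?sqrtC_ge0 // -expr2 sqrtCK.
Qed.

Lemma psd_gramP A : psdmx A -> exists S : 'M[C]_n, A = S ^t* *m S.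
Proof.
move=> /psd_spectral[U [d [_ /diag_gram -> ->]]].
by eexists (_ *m U); rewrite dagM !mulmxA.
Qed.

Lemma psd_congr X A : psdmx A -> psdmx (X ^t* *m A *m X).
Proof.
by move=> /psd_gramP[S ->]; rewrite !mulmxA -dagM -mulmxA; apply: psd_gram.
Qed.

Lemma psd_congrV X A : psdmx A -> psdmx (X *m A *m X ^t*).
Proof. by move=> pA; rewrite -{1}(trmxCK X); apply: psd_congr. Qed.

Lemma psd_bounded A : psdmx A -> exists2 c, 0 <= c & psdmx (c%:M - A).
Proof.
move=> /psd_spectral[U [d [UU d_ge0 ->]]].
exists (\sum_i d 0 i); first exact: sumr_ge0.
set c := \sum_i _.
have -> : c%:M - U ^t* *m diag_mx d *m U =
    U ^t* *m diag_mx (const_mx c - d) *m U.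
  rewrite linearB /= diag_const_mx mulmxBr mulmxBl; congr (_ - _).
  by rewrite mul_mx_scalar -scalemxAl UU scalemx1.
rewrite diag_gram; first exact/psd_congr/psd_gram.
move=> i; rewrite !mxE subr_ge0.
by rewrite /c (bigD1 i) //= lerDl sumr_ge0.
Qed.

Lemma psd0 : psdmx (0 : 'M[C]_n).
Proof. by have := psd_gram (0 : 'M[C]_n); rewrite mulmx0. Qed.

Lemma psdD A B : psdmx A -> psdmx B -> psdmx (A + B).
Proof.
move=> [/hermsymP hA pA] [/hermsymP hB pB].
split; first by apply/hermsymP; rewrite dagD hA hB.
by move=> v; rewrite mulmxDr mulmxDl mxE addr_ge0.
Qed.

Lemma psdZ a A : 0 <= a -> psdmx A -> psdmx (a *: A).
Proof.
move=> a0 [/hermsymP hA pA].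
split; first by apply/hermsymP; rewrite dagZ geC0_conj ?hA.
by move=> v; rewrite -scalemxAr -scalemxAl mxE mulr_ge0.
Qed.

Lemma psd_congr0 A m (X : 'M[C]_(n, m)) :
  psdmx A -> X ^t* *m A *m X = 0 -> A *m X = 0.
Proof.
move=> /psd_gramP[S ->]; rewrite !mulmxA -dagM -!mulmxA => /gram_eq0 ->.
by rewrite mulmx0.
Qed.

Lemma tr_gram_mul (S T : 'M[C]_n) :
  \tr (S ^t* *m S *m (T ^t* *m T)) = \tr ((S *m T ^t*) ^t* *m (S *m T ^t*)).
Proof. by rewrite !dagE mulmxA mxtrace_mulC !mulmxA. Qed.

Lemma psd_tr_ge0 A B : psdmx A -> psdmx B -> 0 <= \tr (A *m B).
Proof.
by move=> /psd_gramP[S ->] /psd_gramP[T ->]; rewrite tr_gram_mul tr_gram_ge0.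
Qed.

Lemma psd_tr_mul_eq0 A B :
  psdmx A -> psdmx B -> \tr (A *m B) = 0 -> A *m B = 0.
Proof.
move=> /psd_gramP[S ->] /psd_gramP[T ->].
rewrite tr_gram_mul => /tr_gram_eq0 ST0.
by rewrite mulmxA -(mulmxA _ S) ST0 mulmx0 mul0mx.
Qed.

Lemma psd_tr_eq0 A : psdmx A -> \tr A = 0 -> A = 0.
Proof. by move=> /psd_gramP[S ->] /tr_gram_eq0 ->; rewrite mulmx0. Qed.

Lemma psd_add_ker A B m (X : 'M[C]_(n, m)) :
  psdmx A -> psdmx B -> (A + B) *m X = 0 -> A *m X = 0.
Proof.
move=> /psd_gramP[S ->] /psd_gramP[T ->] /(congr1 (fun Y => \tr (X ^t* *m Y))).
rewrite mulmxDl mulmxDr mulmx0 mxtraceD mxtrace0 -!mulmxA.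
rewrite !(mulmxA (X ^t*)) -!dagM.
move/eqP; rewrite paddr_eq0 ?tr_gram_ge0 // => /andP[/eqP/tr_gram_eq0 -> _].
by rewrite mulmx0.
Qed.

End Psd.

(** * Necessity *)

Section FirstOrder.
Context {C : numClosedFieldType} {n : nat}.
Implicit Types (E N X Y : 'M[C]_n).

Lemma le0_of_le_scaled (x m : C) :
  0 <= m -> (forall e, 0 < e -> x <= e * m) -> x <= 0.
Proof.
move=> m_ge0 x_le; have m1_gt0 : 0 < m + 1 by rewrite ltr_wpDl.
(* The order of [C] is partial, so [x] must be seen to be real before the inequality can be
   negated. *)
have x_real : x \is Num.real.
  by rewrite (ler_real (x_le 1 ltr01)) mul1r ger0_real.
rewrite real_leNgt ?real0 //; apply/negP => x_gt0.
have := x_le (x / (m + 1)) (divr_gt0 x_gt0 m1_gt0).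
by rewrite mulrAC ler_pdivlMr // ler_pM2l // gerDl ler10.
Qed.

(** The sum is [E] conjugated by [1 + e X], plus [e N]; the term [N] allows velocities that leave
    the range of [E]. *)
Lemma psd_path E N X (e : C) : psdmx E -> psdmx N -> 0 <= e ->
  psdmx (E + e *: (X *m E + E *m X ^t* + N) + e ^+ 2 *: (X *m E *m X ^t*)).
Proof.
move=> pE pN e0; have -> : E + e *: (X *m E + E *m X ^t* + N) +
    e ^+ 2 *: (X *m E *m X ^t*) =
    (1%:M + e *: X) *m E *m (1%:M + e *: X) ^t* + e *: N.
  rewrite dagD dagZ dag1 geC0_conj // !(mulmxDl, mulmxDr, mul1mx, mulmx1).
  rewrite -!scalemxAl -!scalemxAr -?scalemxAl; mx_ring.
by apply: psdD; [apply: psd_congrV | apply: psdZ].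
Qed.

(* X E + E X^* is the velocity at 0 of the path (1 + eX) E (1 + eX)^* of positive
   matrices; the second order terms are absorbed by a rescaling with
   1 / (1 + c e^2). *)
Lemma first_order_optimality g1 g2 E1 E2 E0 X1 X2 Y N1 N2 :
  psdmx g1 -> psdmx g2 -> optimal_usd g1 g2 E1 E2 E0 ->
  psdmx N1 -> psdmx N2 -> N1 *m g2 = 0 -> N2 *m g1 = 0 ->
  g2 *m X1 = 0 -> g1 *m X2 = 0 ->
  let D1 := X1 *m E1 + E1 *m X1 ^t* + N1 in
  let D2 := X2 *m E2 + E2 *m X2 ^t* + N2 in
  D1 + D2 + (Y *m E0 + E0 *m Y ^t*) = 0 ->
  \tr (D1 *m g1) + \tr (D2 *m g2) <= 0.
Proof.
move=> pg1 pg2 [[pE1 pE2 pE0 sumE tr21 tr12] optE].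
move=> pN1 pN2 N1g N2g gX1 gX2 D1 D2 sumD.
have E2g : E2 *m g1 = 0 by apply: psd_tr_mul_eq0.
have E1g : E1 *m g2 = 0 by apply: psd_tr_mul_eq0.
have X1g : X1 ^t* *m g2 = 0 by rewrite -(psd_dag pg2) -dagM gX1 dag0.
have X2g : X2 ^t* *m g1 = 0 by rewrite -(psd_dag pg1) -dagM gX2 dag0.
pose R1 := X1 *m E1 *m X1 ^t*; pose R2 := X2 *m E2 *m X2 ^t*.
pose R0 := Y *m E0 *m Y ^t*.
have pR1 : psdmx R1 by apply: psd_congrV.
have pR2 : psdmx R2 by apply: psd_congrV.
have [c c0 pc] := psd_bounded (psdD (psdD pR1 pR2) (psd_congrV Y pE0)).
have P0 : 0 <= success_prob g1 g2 E1 E2 by rewrite addr_ge0 // psd_tr_ge0.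
apply: (le0_of_le_scaled (mulr_ge0 c0 P0)) => e e_gt0.
have e0 := ltW e_gt0; have s_gt0 : 0 < 1 + c * e ^+ 2.
  by rewrite ltr_wpDr // mulr_ge0 // exprn_ge0.
pose s := (1 + c * e ^+ 2)^-1.
have s0 : 0 <= s by rewrite invr_ge0 ltW.
pose F1 := s *: (E1 + e *: D1 + e ^+ 2 *: R1).
pose F2 := s *: (E2 + e *: D2 + e ^+ 2 *: R2).
(* The new inconclusive effect is its own path, directed by [Y], plus the slack that [c] leaves
   above the second-order terms. *)
have F0E : 1%:M - F1 - F2 =
    s *: (E0 + e *: (Y *m E0 + E0 *m Y ^t* + 0) + e ^+ 2 *: R0) +
    s *: (e ^+ 2 *: (c%:M - (R1 + R2 + R0))).
  have -> : Y *m E0 + E0 *m Y ^t* = - (D1 + D2).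
    by apply/eqP; rewrite -addr_eq0 addrC sumD.
  rewrite -sumE (_ : E0 = 1%:M - E1 - E2); last by rewrite -sumE; mx_ring.
  rewrite /F1 /F2; apply/matrixP => i j; rewrite !mxE.
  rewrite /s; field.
  by rewrite gt_eqF.
have : success_prob g1 g2 F1 F2 <= success_prob g1 g2 E1 E2.
  apply: (optE F1 F2 (1%:M - F1 - F2)); split.
  - exact/psdZ/psd_path.
  - exact/psdZ/psd_path.
  - rewrite F0E; apply: psdD; first exact/psdZ/psd_path/ltW/e_gt0/psd0.
    by do 2!apply: psdZ => //; rewrite exprn_ge0.
  - mx_ring.
  - rewrite /F2 /D2 /R2 -scalemxAl !mulmxDl -!scalemxAl !mulmxDl -!mulmxA.
    by rewrite E2g X2g N2g !(mulmx0, addr0, scaler0) mxtrace0.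
  - rewrite /F1 /D1 /R1 -scalemxAl !mulmxDl -!scalemxAl !mulmxDl -!mulmxA.
    by rewrite E1g X1g N1g !(mulmx0, addr0, scaler0) mxtrace0.
rewrite /success_prob /F1 /F2 -!scalemxAl !mulmxDl -!scalemxAl.
rewrite !(mxtraceZ, mxtraceD) -/(success_prob g1 g2 E1 E2) -mulrDr.
rewrite mulrC ler_pdivrMr // => le_succ.
have r1 := psd_tr_ge0 pR1 pg1; have r2 := psd_tr_ge0 pR2 pg2.
rewrite -(ler_pM2l e_gt0) -subr_ge0.
set p := \tr (E1 *m g1) in le_succ *; set q := \tr (E2 *m g2) in le_succ *.
move: le_succ; rewrite -subr_ge0; set lhs := (X in 0 <= X) => lhs_ge0.
have := addr_ge0 lhs_ge0 (mulr_ge0 (exprn_ge0 2 e0) (addr_ge0 r1 r2)).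
congr (0 <= _).
by rewrite /lhs /success_prob -/p -/q /D1 /D2 !(mulmxDl, mxtraceD); ring.
Qed.

End FirstOrder.

(** * Variations of an optimal measurement *)

Section Frame.
Context {C : numClosedFieldType} {n : nat}.
Implicit Types (g E L X : 'M[C]_n).

Definition gap g1 g2 E0 := E0 *m (g2 - g1) *m E0.

Lemma gapC g1 g2 E0 : gap g2 g1 E0 = - gap g1 g2 E0.
Proof. by rewrite /gap -opprB mulmxN mulNmx. Qed.

Lemma gap_dag g1 g2 E0 : psdmx g1 -> psdmx g2 -> psdmx E0 ->
  (gap g1 g2 E0) ^t* = gap g1 g2 E0.
Proof.
move=> /psd_dag h1 /psd_dag h2 /psd_dag h0.
by rewrite /gap !dagE h1 h2 h0 mulmxA.
Qed.

(** The mixed terms die on the kernels of [g1] and [g2]. This evaluates the gap once [E0 k] is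
    decomposed along the two ranges. *)
Lemma gap_form g1 g2 p q (U1 U2 : 'M[C]_(n, p)) (V1 V2 : 'M[C]_(n, q)) :
  psdmx g1 -> psdmx g2 ->
  g2 *m U1 = 0 -> g1 *m U2 = 0 -> g2 *m V1 = 0 -> g1 *m V2 = 0 ->
  (U1 + U2) ^t* *m (g2 - g1) *m (V1 + V2) =
  U2 ^t* *m g2 *m V2 - U1 ^t* *m g1 *m V1.
Proof.
move=> /psd_dag h1 /psd_dag h2 U1g U2g V1g V2g.
have {}U1g : U1 ^t* *m g2 = 0 by rewrite -h2 -dagM U1g dag0.
have {}U2g : U2 ^t* *m g1 = 0 by rewrite -h1 -dagM U2g dag0.
rewrite dagD mulmxBr (mulmxDl _ _ g1) (mulmxDl _ _ g2) U1g U2g add0r addr0.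
by rewrite mulmxBl !mulmxDr -!mulmxA V1g V2g !mulmx0 add0r addr0.
Qed.

(* L1 and L2 project onto the two subspaces that carry the conclusive effects;
   the last field says that these subspaces meet only in 0. *)
Record usd_frame g1 g2 L1 L2 E1 E2 E0 : Prop := UsdFrame {
  frame_g1 : psdmx g1;
  frame_g2 : psdmx g2;
  frame_E1 : psdmx E1;
  frame_E2 : psdmx E2;
  frame_E0 : psdmx E0;
  frame_sum : E1 + E2 + E0 = 1%:M;
  frame_dag1 : L1 ^t* = L1;
  frame_dag2 : L2 ^t* = L2;
  frame_idem1 : L1 *m L1 = L1;
  frame_idem2 : L2 *m L2 = L2;
  frame_ker1 : g2 *m L1 = 0;
  frame_ker2 : g1 *m L2 = 0;
  frame_sub1 : L1 *m E1 = E1;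
  frame_sub2 : L2 *m E2 = E2;
  frame_indep : forall X Y, L1 *m X = L2 *m Y -> L1 *m X = 0 }.

Lemma frameC g1 g2 L1 L2 E1 E2 E0 :
  usd_frame g1 g2 L1 L2 E1 E2 E0 -> usd_frame g2 g1 L2 L1 E2 E1 E0.
Proof.
move=> fr; have indep := frame_indep fr.
case: fr => *; split; rewrite ?(addrC E2) // => X Y eqXY.
by rewrite eqXY; apply: indep (esym eqXY).
Qed.

Lemma optimal_usdC g1 g2 E1 E2 E0 :
  optimal_usd g1 g2 E1 E2 E0 -> optimal_usd g2 g1 E2 E1 E0.
Proof.
have measC h1 h2 F1 F2 F0 :
    usd_measurement h1 h2 F1 F2 F0 -> usd_measurement h2 h1 F2 F1 F0.
  by case=> *; split; rewrite // (addrC F2).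
case=> /measC mE optE; split=> // F1 F2 F0 /measC /optE.
by rewrite /success_prob addrC [X in _ <= X]addrC.
Qed.

Context {g1 g2 L1 L2 E1 E2 E0 : 'M[C]_n}.
Hypothesis fr : usd_frame g1 g2 L1 L2 E1 E2 E0.
Local Notation M := (gap g1 g2 E0).

Lemma frame_inc : E0 = 1%:M - E1 - E2.
Proof. by rewrite -(frame_sum fr); mx_ring. Qed.

Lemma frame_g2E1 : g2 *m E1 = 0.
Proof. by rewrite -(frame_sub1 fr) mulmxA (frame_ker1 fr) mul0mx. Qed.

Lemma frame_g1E2 : g1 *m E2 = 0.
Proof. by rewrite -(frame_sub2 fr) mulmxA (frame_ker2 fr) mul0mx. Qed.

Lemma frame_kerm1 p (k : 'M[C]_(n, p)) : L1 *m k = k -> g2 *m k = 0.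
Proof. by move=> <-; rewrite mulmxA (frame_ker1 fr) mul0mx. Qed.

Lemma frame_kerm2 p (k : 'M[C]_(n, p)) : L2 *m k = k -> g1 *m k = 0.
Proof. by move=> <-; rewrite mulmxA (frame_ker2 fr) mul0mx. Qed.

Lemma gap_dagE : M ^t* = M.
Proof. by apply: gap_dag; case: fr. Qed.

Lemma gap_sandwich p q (k : 'M[C]_(n, p)) (l : 'M[C]_(n, q)) :
  k ^t* *m M *m l = (E0 *m k) ^t* *m (g2 - g1) *m (E0 *m l).
Proof. by rewrite dagM (psd_dag (frame_E0 fr)) !mulmxA. Qed.

Hypothesis optE : optimal_usd g1 g2 E1 E2 E0.

(* The variation from the header; all directions are doubled in order to avoid
   halves. *)
Lemma optimal_gap_form_ge0 p (k : 'M[C]_(n, p)) :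
  L1 *m k = k -> 0 <= \tr (k ^t* *m M *m k).
Proof.
move=> kL; have g2k := frame_kerm1 kL.
have pg1 := frame_g1 fr; have pg2 := frame_g2 fr.
have dE1 := psd_dag (frame_E1 fr); have dE2 := psd_dag (frame_E2 fr).
have [a aE] : {a | a = k - E1 *m k} by exists (k - E1 *m k).
have [b bE] : {b | b = E2 *m k} by exists (E2 *m k).
have g2a : g2 *m a = 0 by rewrite aE mulmxBr g2k mulmxA frame_g2E1 mul0mx subr0.
have ag2 : a ^t* *m g2 = 0 by rewrite -(psd_dag pg2) -dagM g2a dag0.
have g1b : g1 *m b = 0 by rewrite bE mulmxA frame_g1E2 mul0mx.
have g1Nb : g1 *m - b = 0 by rewrite mulmxN g1b oppr0.
have E0k : E0 *m k = a + - b by rewrite frame_inc aE bE; mx_ring.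
have paa : psdmx (a *m a ^t*) by rewrite -{1}(trmxCK a); apply: psd_gram.
(* As [k ^t* *m E2] is [b ^t*], the decrease of [E2] is the velocity given by [- b k^*]; [Y] acts in
   the same way on [E0 k = a - b], and the increase of [E1] enters as [N1]. *)
have := @first_order_optimality _ _ g1 g2 E1 E2 E0 0 (- (b *m k ^t*))
  (- ((a + b) *m k ^t*)) (a *m a ^t* + a *m a ^t*) 0 pg1 pg2 optE
  (psdD paa paa) psd0.
have -> : - (b *m k ^t*) *m E2 + E2 *m (- (b *m k ^t*)) ^t* =
     - (b *m b ^t* + b *m b ^t*).
  by rewrite bE !dagE dE2; mx_ring.
have -> : - ((a + b) *m k ^t*) *m E0 + E0 *m (- ((a + b) *m k ^t*)) ^t* =
     - (a *m a ^t* + a *m a ^t*) + (b *m b ^t* + b *m b ^t*).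
  by rewrite frame_inc aE bE !dagE dE1 dE2; mx_ring.
rewrite dag0 !(mul0mx, mulmx0) !addr0 add0r => H.
have {}H : \tr ((a *m a ^t* + a *m a ^t*) *m g1) +
    \tr (- (b *m b ^t* + b *m b ^t*) *m g2) <= 0.
  apply: H => //; last by mx_ring.
  - by rewrite mulmxDl -mulmxA ag2 mulmx0 addr0.
  - by rewrite mulmxN mulmxA g1b mul0mx oppr0.
rewrite gap_sandwich E0k gap_form // -oppr_le0.
rewrite -(pmulrn_lle0 _ (isT : (0 < 2)%N)).
apply: le_trans H; rewrite le_eqVlt; apply/orP; left; apply/eqP.
rewrite dagN !mulNmx mulmxN opprK !mulmxDl !(mxtraceD, mxtraceN).
rewrite -!(mulmxA _ _ g1) -!(mulmxA _ _ g2) !(mxtrace_mulC _ (_ ^t* *m _)).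
ring.
Qed.

(* For k = E1 the vectors a are in the range of E1, so that the variation can be
   reversed. *)
Lemma optimal_gap_form_le0 : \tr (E1 *m M *m E1) <= 0.
Proof.
have pg1 := frame_g1 fr; have pg2 := frame_g2 fr.
have dE1 := psd_dag (frame_E1 fr); have dE2 := psd_dag (frame_E2 fr).
have [a aE] : {a | a = E1 - E1 *m E1} by exists (E1 - E1 *m E1).
have [b bE] : {b | b = E2 *m E1} by exists (E2 *m E1).
have g2a : g2 *m a = 0 by rewrite aE mulmxBr mulmxA frame_g2E1 mul0mx subr0.
have g1b : g1 *m b = 0 by rewrite bE mulmxA frame_g1E2 mul0mx.
have bg1 : b ^t* *m g1 = 0 by rewrite -(psd_dag pg1) -dagM g1b dag0.
have g1Nb : g1 *m - b = 0 by rewrite mulmxN g1b oppr0.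
have E0k : E0 *m E1 = a + - b by rewrite frame_inc aE bE; mx_ring.
have pbb : psdmx (b *m b ^t*) by rewrite -{1}(trmxCK b); apply: psd_gram.
(* Since [a = (1 - E1) E1], the choice [X1 = - a (1 - E1)] gives [X1 E1 = - a a^*], so [E1] can be
   decreased. *)
have := @first_order_optimality _ _ g1 g2 E1 E2 E0 (- (a *m (1%:M - E1))) 0
  ((a + b) *m E1) 0 (b *m b ^t* + b *m b ^t*) pg1 pg2 optE psd0 (psdD pbb pbb).
have -> : - (a *m (1%:M - E1)) *m E1 + E1 *m (- (a *m (1%:M - E1))) ^t* =
     - (a *m a ^t* + a *m a ^t*).
  by rewrite aE !dagE dE1; mx_ring.
have -> : (a + b) *m E1 *m E0 + E0 *m ((a + b) *m E1) ^t* =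
     (a *m a ^t* + a *m a ^t*) - (b *m b ^t* + b *m b ^t*).
  by rewrite frame_inc aE bE !dagE dE1 dE2; mx_ring.
rewrite dag0 !(mul0mx, mulmx0) !addr0 add0r => H.
have {}H : \tr (- (a *m a ^t* + a *m a ^t*) *m g1) +
    \tr ((b *m b ^t* + b *m b ^t*) *m g2) <= 0.
  apply: H => //; last by mx_ring.
  - by rewrite mulmxDl -mulmxA bg1 mulmx0 addr0.
  - by rewrite mulmxN mulmxA g2a mul0mx oppr0.
rewrite -{1}dE1 gap_sandwich E0k gap_form // -(pmulrn_lle0 _ (isT : (0 < 2)%N)).
apply: le_trans H; rewrite le_eqVlt; apply/orP; left; apply/eqP.
rewrite dagN !mulNmx mulmxN opprK !mulmxDl !(mxtraceD, mxtraceN).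
rewrite -!(mulmxA _ _ g1) -!(mulmxA _ _ g2) !(mxtrace_mulC _ (_ ^t* *m _)).
ring.
Qed.

(** Polarized variation. Each mixed product contains [c = E1 l] or [b = E2 k], so both changes are
    velocities of congruence paths, without positive increments. The bound is real-linear in [k] and
    thus holds with either sign. *)
Lemma optimal_gap_cross p (k l : 'M[C]_(n, p)) : L1 *m k = k -> L2 *m l = l ->
  0 <= \tr (k ^t* *m M *m l + l ^t* *m M *m k).
Proof.
move=> kL lL; have g2k := frame_kerm1 kL; have g1l := frame_kerm2 lL.
have pg1 := frame_g1 fr; have pg2 := frame_g2 fr.
have dE1 := psd_dag (frame_E1 fr); have dE2 := psd_dag (frame_E2 fr).
have [a aE] : {a | a = k - E1 *m k} by exists (k - E1 *m k).
have [b bE] : {b | b = E2 *m k} by exists (E2 *m k).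
have [c cE] : {c | c = E1 *m l} by exists (E1 *m l).
have [d dE] : {d | d = l - E2 *m l} by exists (l - E2 *m l).
have g2a : g2 *m a = 0 by rewrite aE mulmxBr g2k mulmxA frame_g2E1 mul0mx subr0.
have g1b : g1 *m b = 0 by rewrite bE mulmxA frame_g1E2 mul0mx.
have g2c : g2 *m c = 0 by rewrite cE mulmxA frame_g2E1 mul0mx.
have g1d : g1 *m d = 0 by rewrite dE mulmxBr g1l mulmxA frame_g1E2 mul0mx subr0.
have g1Nb : g1 *m - b = 0 by rewrite mulmxN g1b oppr0.
have g2Nc : g2 *m - c = 0 by rewrite mulmxN g2c oppr0.
have E0k : E0 *m k = a + - b by rewrite frame_inc aE bE; mx_ring.
have E0l : E0 *m l = - c + d by rewrite frame_inc cE dE; mx_ring.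
have := @first_order_optimality _ _ g1 g2 E1 E2 E0
  (- (a *m l ^t* + a *m l ^t*)) (d *m k ^t* + d *m k ^t*)
  ((c + d) *m k ^t* - (a + b) *m l ^t*) 0 0 pg1 pg2 optE psd0 psd0.
set A := a *m c ^t* + c *m a ^t*; set B := b *m d ^t* + d *m b ^t*.
have -> : - (a *m l ^t* + a *m l ^t*) *m E1 +
    E1 *m (- (a *m l ^t* + a *m l ^t*)) ^t* = - (A + A).
  by rewrite /A aE cE !dagE dE1; mx_ring.
have -> : (d *m k ^t* + d *m k ^t*) *m E2 +
    E2 *m (d *m k ^t* + d *m k ^t*) ^t* = B + B.
  by rewrite /B bE dE !dagE dE2; mx_ring.
have -> : ((c + d) *m k ^t* - (a + b) *m l ^t*) *m E0 +
    E0 *m ((c + d) *m k ^t* - (a + b) *m l ^t*) ^t* = (A + A) - (B + B).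
  by rewrite frame_inc /A /B aE bE cE dE !dagE dE1 dE2; mx_ring.
rewrite !(mul0mx, addr0) => H.
have {}H : \tr (- (A + A) *m g1) + \tr ((B + B) *m g2) <= 0.
  apply: H => //; last by rewrite addrC addrACA; mx_ring.
  - by rewrite mulmxN mulmxDr mulmxA g2a mul0mx addr0 oppr0.
  - by rewrite mulmxDr mulmxA g1d mul0mx addr0.
rewrite !gap_sandwich E0k E0l !gap_form // -oppr_le0.
rewrite -(pmulrn_lle0 _ (isT : (0 < 2)%N)).
apply: le_trans H; rewrite le_eqVlt; apply/orP; left; apply/eqP.
rewrite /A /B !dagN !mulNmx !mulmxN ?opprK !mulmxDl !(mxtraceD, mxtraceN).
rewrite -!(mulmxA _ _ g1) -!(mulmxA _ _ g2) !(mxtrace_mulC _ (_ ^t* *m _)).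
ring.
Qed.

Lemma optimal_gap : [/\ L1 *m M *m L2 = 0, psdmx (L1 *m M *m L1) &
  L1 *m M *m (E1 + E2) = 0].
Proof.
have dL1 := frame_dag1 fr; have idL1 := frame_idem1 fr.
have idL2 := frame_idem2 fr; have E2L := frame_sub2 fr.
have pE1 := frame_E1 fr; have dE1 := psd_dag pE1; have L1E := frame_sub1 fr.
have EL1 : E1 *m L1 = E1 by rewrite -dE1 -{1}dL1 -dagM L1E.
have dM := gap_dagE; have ge0 := optimal_gap_form_ge0.
have le0 := optimal_gap_form_le0; have cross := optimal_gap_cross.
move: M dM ge0 le0 cross => N dN ge0 le0 cross.
have pM : psdmx (L1 *m N *m L1).
  split; first by apply/hermsymP; rewrite !dagM dN dL1 mulmxA.
  move=> v; have := ge0 _ (L1 *m v).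
  rewrite mulmxA idL1 dagM dL1 => /(_ erefl).
  by rewrite /mxtrace big_ord1 !mulmxA.
have LML : L1 *m N *m L2 = 0.
  apply: tr_gram_eq0; set Q := L1 *m N *m L2.
  have NL : L1 *m Q = Q by rewrite /Q !mulmxA idL1.
  have LN : Q ^t* *m L1 = Q ^t* by rewrite -{1}dL1 -dagM NL.
  (* This test pair turns the cross bound into minus twice the squared norm of [Q]. *)
  have := cross _ (- Q) L2; rewrite mulmxN NL idL2 => /(_ erefl erefl).
  have -> : L2 ^t* *m N *m - Q = ((- Q) ^t* *m N *m L2) ^t*.
    by rewrite !dagM trmxCK dN mulmxA.
  have -> : (- Q) ^t* *m N *m L2 = - (Q ^t* *m Q).
    by rewrite [in RHS]/Q !mulmxA LN dagN !mulNmx.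
  rewrite dagN (dagM (Q ^t*) Q) trmxCK.
  rewrite -opprD mxtraceN oppr_ge0 mxtraceD -mulr2n pmulrn_lle0 // => tr_le0.
  by apply/eqP; rewrite eq_le tr_le0 tr_gram_ge0.
(* The [E2] term contains [L1 *m N *m L2]. For the [E1] term, two opposite bounds make the form of
   the positive block vanish on [E1]. *)
split=> //; rewrite mulmxDr -[in X in _ + X]E2L [in X in _ + X]mulmxA.
rewrite LML mul0mx addr0 -L1E mulmxA; apply: psd_congr0 => //.
have -> : E1 ^t* *m (L1 *m N *m L1) *m E1 = E1 *m N *m E1.
  by rewrite dE1 !mulmxA EL1 -[_ *m L1 *m E1]mulmxA L1E.
apply: psd_tr_eq0.
  have := psd_congr E1 pM.
  by rewrite dE1 !mulmxA EL1 -[_ *m L1 *m E1]mulmxA L1E.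
apply/eqP; rewrite eq_le le0 /=.
by have := ge0 _ E1 L1E; rewrite dE1.
Qed.

End Frame.

(** * Sufficiency *)

Section Projection.
Context {C : numClosedFieldType} {n : nat}.
Implicit Types (A F P Q S X : 'M[C]_n).

(** Adjoints turn the pseudo-inverse for rows into a right inverse [T] of [A] on its range; the last
    factor [Q] makes [T] vanish on the orthogonal complement. *)
Lemma range_proj A : A ^t* = A -> exists Q T : 'M[C]_n,
  [/\ Q ^t* = Q, Q *m Q = Q, A *m Q = A, A *m T = Q & T *m Q = T].
Proof.
move=> dA; pose Q := proj_ortho A.
have dQ : Q ^t* = Q by apply: proj_ortho_herm.
have QQ : Q *m Q = Q by apply: proj_ortho_proj.
exists Q, ((Q *m pinvmx A) ^t* *m Q); split=> //; first exact: proj_ortho_id.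
  by rewrite mulmxA -{1}dA -dagM mulmxKpV ?proj_orthoE // dQ.
by rewrite -mulmxA QQ.
Qed.

(* With F = S ^t* S, the two summands come from the splitting of S along the
   range of S P1. *)
Lemma psd_split F P1 P2 : psdmx F -> P1 ^t* = P1 -> P1 *m F *m P2 = 0 ->
  exists Ha Hb,
    [/\ psdmx Ha, psdmx Hb, F = Ha + Hb, Ha *m P2 = 0 & Hb *m P1 = 0].
Proof.
move=> /psd_gramP[S ->] dP1 PFP; pose Q := proj_ortho (P1 *m S ^t*).
have dQ : Q ^t* = Q by apply: proj_ortho_herm.
have QQ : Q *m Q = Q by apply: proj_ortho_proj.
have QS : P1 *m S ^t* *m Q = P1 *m S ^t* by apply: proj_ortho_id.
have defQ : Q = Q *m pinvmx (P1 *m S ^t*) *m (P1 *m S ^t*).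
  by rewrite mulmxKpV // proj_orthoE.
exists (S ^t* *m Q *m S), (S ^t* *m (1%:M - Q) *m S); split.
- by rewrite -QQ -{1}dQ mulmxA -dagM -mulmxA; apply: psd_gram.
- have -> : S ^t* *m (1%:M - Q) *m S =
      ((1%:M - Q) *m S) ^t* *m ((1%:M - Q) *m S).
    rewrite dagM mulmxA -(mulmxA _ _ (1%:M - Q)); congr (_ *m _ *m _).
    by rewrite dagD dag1 dagN dQ mulmxBr mulmx1 mulmxBl QQ mul1mx subrr subr0.
  exact: psd_gram.
- by mx_ring.
- rewrite defQ -!mulmxA (mulmxA P1) (mulmxA (P1 *m _)) -(mulmxA P1) PFP.
  by rewrite !mulmx0.
- have QSP : Q *m (S *m P1) = S *m P1.
    by rewrite -{1}dQ -[S in LHS]trmxCK -dP1 -!dagM QS dagM trmxCK.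
  by rewrite -!mulmxA mulmxBl mul1mx QSP subrr mulmx0.
Qed.

End Projection.

(** * Dual solution and weak duality *)

Section Sufficiency.
Context {C : numClosedFieldType} {n : nat}.
Implicit Types (g E F L X : 'M[C]_n).

Definition gap_optimal g1 g2 L1 L2 E1 E2 E0 : Prop :=
  let M := gap g1 g2 E0 in
  [/\ L1 *m M *m L2 = 0, psdmx (L1 *m M *m L1), psdmx (- (L2 *m M *m L2)),
      L1 *m M *m (E1 + E2) = 0 & L2 *m M *m (E1 + E2) = 0].

Lemma gap_optimalC g1 g2 L1 L2 E1 E2 E0 : usd_frame g1 g2 L1 L2 E1 E2 E0 ->
  gap_optimal g1 g2 L1 L2 E1 E2 E0 -> gap_optimal g2 g1 L2 L1 E2 E1 E0.
Proof.
move=> fr [LML p1 p2 z1 z2].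
rewrite /gap_optimal (gapC g1 g2) !mulmxN !mulNmx opprK (addrC E2) z1 z2 oppr0.
split=> //.
rewrite -(gap_dagE fr) -(frame_dag1 fr) -{1}(frame_dag2 fr) -!dagM mulmxA.
by rewrite LML dag0 oppr0.
Qed.

(** The prescribed block of [Z] on the range of [L1]; exchanging the states gives the one for [L2],
    with the opposite sign of the gap. *)
Definition dual_block g1 g2 L1 E0 := L1 *m (g1 + gap g1 g2 E0) *m L1.

Section OneSided.
Context {g1 g2 L1 L2 E1 E2 E0 : 'M[C]_n}.
Hypothesis fr : usd_frame g1 g2 L1 L2 E1 E2 E0.
Hypothesis opt : gap_optimal g1 g2 L1 L2 E1 E2 E0.
Local Notation M := (gap g1 g2 E0).
Local Notation Z1 := (dual_block g1 g2 L1 E0).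

Lemma dual_block_psd : psdmx Z1.
Proof.
case: opt => _ p1 _ _ _; rewrite /dual_block mulmxDr mulmxDl.
apply: psdD => //; rewrite -{1}(frame_dag1 fr); exact/psd_congr/(frame_g1 fr).
Qed.

Lemma dual_block_mulr : Z1 *m L1 = Z1.
Proof. by rewrite /dual_block -mulmxA (frame_idem1 fr). Qed.

(* Both sides are the value of a dual solution Z with Z E0 = 0: U1 and - U2
   differ by an element of the range of E0. *)
Lemma gap_form_balance p (V U1 U2 : 'M[C]_(n, p)) :
  E0 *m V = U1 + U2 -> L1 *m U1 = U1 -> L2 *m U2 = U2 ->
  U1 ^t* *m (g1 + gap g1 g2 E0) *m U1 = U2 ^t* *m (g2 + gap g2 g1 E0) *m U2.
Proof.
case: opt => LML _ _ z1 z2 E0V U1L U2L; rewrite (gapC g1 g2).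
have dL1 := frame_dag1 fr; have dL2 := frame_dag2 fr.
have pg1 := frame_g1 fr; have pg2 := frame_g2 fr.
have dE1 := psd_dag (frame_E1 fr); have dE2 := psd_dag (frame_E2 fr).
have E1L := frame_sub1 fr; have E2L := frame_sub2 fr.
(* The form of the gap at [V] is computed twice: from [E0 *m V], and from
   [V = U1 + U2 + (E1 + E2) V], where the conditions leave only the diagonal terms in [U1] and
   [U2]. *)
have VNV := gap_sandwich fr V V.
rewrite E0V gap_form ?(frame_kerm1 fr) ?(frame_kerm2 fr) // in VNV.
have defV : V = U1 + U2 + (E1 + E2) *m V.
  by rewrite -E0V -mulmxDl addrC (frame_sum fr) mul1mx.
have dM := gap_dagE fr.
move: LML z1 z2 VNV dM; move: M => N LML z1 z2 VNV dN.
set S := E1 + E2 in z1 z2 defV; have dS : S ^t* = S by rewrite dagD dE1 dE2.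
have SNS : S *m N *m S = 0.
  rewrite -{1}dS dagD -E1L -E2L !dagM dL1 dL2 !mulmxDl -!mulmxA.
  by rewrite !(mulmxA L1) !(mulmxA L2) z1 z2 !mulmx0 addr0.
have U1NU2 : U1 ^t* *m N *m U2 = 0.
  rewrite -U1L -U2L dagM dL1 -!mulmxA !(mulmxA L1) (mulmxA (L1 *m N)) LML.
  by rewrite mul0mx mulmx0.
have U2NU1 : U2 ^t* *m N *m U1 = 0.
  by apply: dag_eq0; rewrite !dagM trmxCK dN mulmxA.
have U1NW : U1 ^t* *m N *m (S *m V) = 0.
  rewrite -U1L dagM dL1 -!mulmxA !(mulmxA L1) (mulmxA (L1 *m N)) z1.
  by rewrite mul0mx mulmx0.
have U2NW : U2 ^t* *m N *m (S *m V) = 0.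
  rewrite -U2L dagM dL2 -!mulmxA !(mulmxA L2) (mulmxA (L2 *m N)) z2.
  by rewrite mul0mx mulmx0.
have WNW : (S *m V) ^t* *m N *m (S *m V) = 0.
  by rewrite dagM dS -!mulmxA !(mulmxA S) (mulmxA (S *m N)) SNS mul0mx mulmx0.
move: (S *m V) defV U1NW U2NW WNW => W defV U1NW U2NW WNW.
have WNU1 : W ^t* *m N *m U1 = 0.
  by apply: dag_eq0; rewrite !dagM trmxCK dN mulmxA.
have WNU2 : W ^t* *m N *m U2 = 0.
  by apply: dag_eq0; rewrite !dagM trmxCK dN mulmxA.
have eqN : V ^t* *m N *m V = U1 ^t* *m N *m U1 + U2 ^t* *m N *m U2.
  rewrite defV !dagD !(mulmxDl, mulmxDr) U1NU2 U2NU1 U1NW U2NW WNW WNU1 WNU2.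
  by rewrite !(addr0, add0r).
rewrite {}VNV in eqN; rewrite !(mulmxDl, mulmxDr) mulmxN mulNmx.
by apply/eqP; rewrite eq_sym subr_eq -addrA -eqN addrC subrK.
Qed.

(** By the balance with [U2 = 0], the form of the positive block vanishes at [E0 V]. This makes the
    block compatible with [Z E0 = 0]. *)
Lemma dual_block_range p (V : 'M[C]_(n, p)) :
  L1 *m (E0 *m V) = E0 *m V -> Z1 *m (E0 *m V) = 0.
Proof.
move=> VL; apply: psd_congr0 dual_block_psd _; rewrite /dual_block.
have := gap_form_balance (V := V) (U1 := E0 *m V) (U2 := 0).
rewrite addr0 !mulmx0 => /(_ erefl VL erefl).
by rewrite !mulmxA -{1}VL dagM (frame_dag1 fr) -!mulmxA VL.
Qed.

Lemma gap_conclusive : L1 *m M *m E1 = 0.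
Proof.
case: opt => LML _ _ z1 _; move: z1.
by rewrite mulmxDr -[in X in _ + X](frame_sub2 fr) mulmxA LML mul0mx addr0.
Qed.

(** * Lift of a dual block to the sum of the ranges of [L1] and [E0] *)

Section Lift.
Context {Q T : 'M[C]_n}.
Hypotheses (dQ : Q ^t* = Q) (AQ : (L1 + E0) *m Q = L1 + E0).
Hypotheses (AT : (L1 + E0) *m T = Q) (TQ : T *m Q = T).
Local Notation Za := (T ^t* *m Z1 *m T).

Lemma lift_L1Q : L1 *m Q = L1.
Proof.
have pL1 : psdmx L1.
  by rewrite -(frame_idem1 fr) -{1}(frame_dag1 fr); apply: psd_gram.
apply/eqP; rewrite -subr_eq0 -opprB oppr_eq0 -{1}[L1]mulmx1 -mulmxBr; apply/eqP.
apply: psd_add_ker pL1 (frame_E0 fr) _.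
by rewrite mulmxBr mulmx1 AQ subrr.
Qed.

Lemma lift_E0Q : E0 *m Q = E0.
Proof. by apply: (addrI (L1 *m Q)); rewrite -mulmxDl AQ lift_L1Q. Qed.

Lemma lift_QL1 : Q *m L1 = L1.
Proof. by rewrite -{1}(frame_dag1 fr) -dQ -dagM lift_L1Q (frame_dag1 fr). Qed.

Lemma lift_QE0 : Q *m E0 = E0.
Proof.
have dE0 := psd_dag (frame_E0 fr).
by rewrite -{1}dE0 -dQ -dagM lift_E0Q dE0.
Qed.

(** [T] decomposes [X] along the ranges of [L1] and [E0]. [Za] evaluates the block at the first
    component, whose ambiguity lies in both ranges and is killed by [dual_block_range]. *)
Lemma lift_L1T X : Q *m X = X -> L1 *m (T *m X) = X - E0 *m (T *m X).
Proof.
by move=> QX; apply/eqP; rewrite eq_sym subr_eq -mulmxDl mulmxA AT QX.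
Qed.

Lemma lift_psd : psdmx Za.
Proof. exact/psd_congr/dual_block_psd. Qed.

Lemma lift_mulQl : Q *m Za = Za.
Proof.
have dZ := psd_dag lift_psd.
by rewrite -{1}dQ -{1}dZ -dagM -mulmxA TQ dZ. Qed.

Lemma lift_E0 : Za *m E0 = 0.
Proof.
have TE := lift_L1T lift_QE0.
rewrite -2!mulmxA -dual_block_mulr -(mulmxA _ L1) TE.
have -> : E0 - E0 *m (T *m E0) = E0 *m (1%:M - T *m E0).
  by rewrite mulmxBr mulmx1.
rewrite dual_block_range ?mulmx0 // mulmxBr mulmx1 -TE mulmxA.
by rewrite (frame_idem1 fr).
Qed.

Lemma lift_L1 : L1 *m Za *m L1 = Z1.
Proof.
have TL := lift_L1T lift_QL1.
have ZTL : Z1 *m T *m L1 = Z1.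
  rewrite -mulmxA -{1}dual_block_mulr -(mulmxA _ L1) TL mulmxBr.
  rewrite dual_block_mulr dual_block_range ?subr0 //.
  have -> : E0 *m (T *m L1) = L1 - L1 *m (T *m L1).
    by rewrite TL opprB addrC subrK.
  by rewrite mulmxBr (mulmxA L1 L1) (frame_idem1 fr).
have LTZ : L1 *m T ^t* *m Z1 = Z1.
  have dZ := psd_dag dual_block_psd.
  by rewrite -{1}(frame_dag1 fr) -dagM -{1}dZ -dagM mulmxA ZTL dZ.
by rewrite !(mulmxA L1) -(mulmxA _ T) -(mulmxA _ Z1) (mulmxA Z1) ZTL LTZ.
Qed.

(** Where [L1] and [E0] vanish, so does [E1], and the sum of the effects leaves [E2] as the identity
    there. *)
Lemma lift_compl_sub : L2 *m (1%:M - Q) = 1%:M - Q.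
Proof.
have L1Q0 : L1 *m (1%:M - Q) = 0 by rewrite mulmxBr mulmx1 lift_L1Q subrr.
have E0Q0 : E0 *m (1%:M - Q) = 0 by rewrite mulmxBr mulmx1 lift_E0Q subrr.
have E1L : E1 *m L1 = E1.
  have dE1 := psd_dag (frame_E1 fr).
  by rewrite -{1}dE1 -(frame_dag1 fr) -dagM (frame_sub1 fr).
have -> : 1%:M - Q = E2 *m (1%:M - Q).
  rewrite -[LHS]mul1mx -{1}(frame_sum fr) !mulmxDl E0Q0 -{1}E1L -mulmxA L1Q0.
  by rewrite mulmx0 add0r addr0.
by rewrite mulmxA (frame_sub2 fr).
Qed.

End Lift.
End OneSided.

(* Z is glued from lifts Za and Zb of the two dual blocks, which vanish on the
   orthogonal complements of the ranges of Q1 and Q2 and agree on the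
   intersection of these ranges.  The block of Z between the two complements is
   arbitrary, and is left equal to 0. *)
Lemma dual_solution g1 g2 L1 L2 E1 E2 E0 :
  usd_frame g1 g2 L1 L2 E1 E2 E0 -> gap_optimal g1 g2 L1 L2 E1 E2 E0 ->
  exists Z Q1 Q2 : 'M[C]_n,
  [/\ Z *m E0 = 0,
      L1 *m Z *m L1 = dual_block g1 g2 L1 E0,
      L2 *m Z *m L2 = dual_block g2 g1 L2 E0
    & [/\ Q1 ^t* = Q1, L1 *m Q1 = L1 & psdmx (Q1 *m Z *m Q1)] /\
      [/\ Q2 ^t* = Q2, L2 *m Q2 = L2, psdmx (Q2 *m Z *m Q2)
        & (1%:M - Q2) *m (1%:M - Q1) = 0]].
Proof.
move=> fr opt; have frV := frameC fr; have optV := gap_optimalC fr opt.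
have dE0 := psd_dag (frame_E0 fr).
have [|Q1 [T1 [dQ1 QQ1 AQ1 AT1 TQ1]]] := range_proj (A := L1 + E0).
  by rewrite dagD dE0 (frame_dag1 fr).
have [|Q2 [T2 [dQ2 QQ2 AQ2 AT2 TQ2]]] := range_proj (A := L2 + E0).
  by rewrite dagD dE0 (frame_dag2 fr).
have L1Q := lift_L1Q fr AQ1; have L2Q := lift_L1Q frV AQ2.
have QL1 := lift_QL1 fr dQ1 AQ1; have QL2 := lift_QL1 frV dQ2 AQ2.
have QE1 := lift_QE0 fr dQ1 AQ1; have QE2 := lift_QE0 frV dQ2 AQ2.
have Q21 : (1%:M - Q2) *m (1%:M - Q1) = 0.
  by rewrite -(lift_compl_sub fr AQ1) mulmxA mulmxBl mul1mx QL2 subrr mul0mx.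
have defQ21 : Q2 *m Q1 = Q1 + Q2 - 1%:M.
  apply/eqP; rewrite -subr_eq0 -Q21; apply/eqP; mx_ring.
have defQ12 : Q1 *m Q2 = Q2 *m Q1.
  by rewrite -{1}dQ1 -{1}dQ2 -dagM defQ21 !dagE dQ1 dQ2.
(* [Q1] and [Q2] commute as their complements are orthogonal, so [H] projects onto the intersection
   of their ranges. *)
have [H HE] : {H | H = Q2 *m Q1} by exists (Q2 *m Q1).
rewrite -HE in defQ12.
have dH : H ^t* = H by rewrite HE dagM dQ1 dQ2 defQ12.
have Q1H : Q1 *m H = H by rewrite -defQ12 mulmxA QQ1.
have Q2H : Q2 *m H = H by rewrite HE mulmxA QQ2.
have HE0 : H *m E0 = E0 by rewrite HE -mulmxA QE1.
have [Za ZaDef] : {Z | Z = T1 ^t* *m dual_block g1 g2 L1 E0 *m T1} by eexists.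
have [Zb ZbDef] : {Z | Z = T2 ^t* *m dual_block g2 g1 L2 E0 *m T2} by eexists.
have ZaQ : Za *m Q1 = Za by rewrite ZaDef -mulmxA TQ1.
have ZbQ : Zb *m Q2 = Zb by rewrite ZbDef -mulmxA TQ2.
have := lift_mulQl fr opt dQ1 TQ1; rewrite -ZaDef => QZa.
have := lift_mulQl frV optV dQ2 TQ2; rewrite -ZbDef => QZb.
have := lift_E0 fr opt dQ1 AQ1 AT1; rewrite -ZaDef => ZaE.
have := lift_E0 frV optV dQ2 AQ2 AT2; rewrite -ZbDef => ZbE.
have := lift_L1 fr opt dQ1 AQ1 AT1; rewrite -ZaDef => LZa.
have := lift_L1 frV optV dQ2 AQ2 AT2; rewrite -ZbDef => LZb.
have := lift_psd (T := T1) fr opt; rewrite -ZaDef => pZa.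
have := lift_psd (T := T2) frV optV; rewrite -ZbDef => pZb.
have HZa : H *m Za *m H = Q2 *m Za *m Q2.
  by rewrite {1}HE -(mulmxA Q2) QZa -defQ12 mulmxA -(mulmxA Q2) ZaQ.
have HZb : H *m Zb *m H = Q1 *m Zb *m Q1.
  by rewrite -{1}defQ12 -(mulmxA Q1) QZb HE mulmxA -(mulmxA Q1) ZbQ.
have Zab : H *m Za *m H = H *m Zb *m H.
  have UE := lift_L1T AT1 Q1H; have VE := lift_L1T AT2 Q2H.
  (* For this [V], [E0 V] is the difference of the components of [H] in the ranges of [L1] and [L2],
     at which the two lifts evaluate their blocks. *)
  have := gap_form_balance fr opt (V := T2 *m H - T1 *m H)
    (U1 := L1 *m (T1 *m H)) (U2 := - (L2 *m (T2 *m H))).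
  rewrite mulmxN !mulmxA (frame_idem1 fr) (frame_idem2 fr) -!mulmxA => bal.
  have {bal} := bal _ erefl erefl; rewrite UE VE mulmxBr.
  have -> : E0 *m (T2 *m H) - E0 *m (T1 *m H) =
      H - E0 *m (T1 *m H) - (H - E0 *m (T2 *m H)) by mx_ring.
  move=> /(_ erefl); rewrite -UE -VE dagN !mulNmx !mulmxN opprK.
  rewrite !dagM (frame_dag1 fr) (frame_dag2 fr) dH => bal.
  by rewrite ZaDef ZbDef /dual_block !mulmxA in bal *.
(* The intersection is counted once: compression by [Q1] leaves [Za], and compression by [Q2] leaves
   [Zb]. *)
exists (Za + Zb - H *m Za *m H), Q1, Q2; split.
- rewrite mulmxBl mulmxDl ZaE ZbE -(mulmxA _ H E0) HE0 -mulmxA ZaE.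
  by rewrite mulmx0 addr0 subr0.
- rewrite -LZa Zab HZb mulmxBr mulmxDr mulmxBl mulmxDl.
  by rewrite !mulmxA L1Q -(mulmxA _ Q1 L1) QL1 addrK.
- rewrite -LZb HZa mulmxBr mulmxDr mulmxBl mulmxDl.
  by rewrite !mulmxA L2Q -(mulmxA _ Q2 L2) QL2 addrC addKr.
split; split=> //.
- rewrite Zab HZb mulmxBr mulmxDr mulmxBl mulmxDl.
  by rewrite !mulmxA QQ1 -(mulmxA _ Q1 Q1) QQ1 addrK QZa ZaQ.
- rewrite HZa mulmxBr mulmxDr mulmxBl mulmxDl.
  by rewrite !mulmxA QQ2 -(mulmxA _ Q2 Q2) QQ2 addrC addKr QZb ZbQ.
Qed.

(** [psd_split] cuts [F] into one summand living in the range of [Q1] and one in that of [Q2]; [Z]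
    is positive on each. *)
Lemma tr_dual_ge0 F Z Q1 Q2 :
  psdmx F -> Q1 ^t* = Q1 -> Q2 ^t* = Q2 ->
  psdmx (Q1 *m Z *m Q1) -> psdmx (Q2 *m Z *m Q2) ->
  (1%:M - Q2) *m F *m (1%:M - Q1) = 0 -> 0 <= \tr (F *m Z).
Proof.
have compress (G : 'M[C]_n) Q : psdmx G -> Q ^t* = Q -> psdmx (Q *m Z *m Q) ->
    G *m (1%:M - Q) = 0 -> 0 <= \tr (G *m Z).
  move=> pG dQ pQ; rewrite mulmxBr mulmx1 => /eqP; rewrite subr_eq0 => /eqP GQ.
  have QG : Q *m G = G by rewrite -{1}dQ -(psd_dag pG) -dagM -GQ.
  by rewrite {1}GQ -{1}QG -!mulmxA mxtrace_mulC -!mulmxA psd_tr_ge0 // mulmxA.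
move=> pF dQ1 dQ2 pQ1 pQ2 F0.
have dP2 : (1%:M - Q2) ^t* = 1%:M - Q2 by rewrite !dagE dQ2.
have [Ha [Hb [pa pb -> Ha0 Hb0]]] := psd_split pF dP2 F0.
rewrite mulmxDl mxtraceD.
by apply: addr_ge0; [apply: (compress _ Q1) | apply: (compress _ Q2)].
Qed.

Lemma frame_mulr1 g1 g2 L1 L2 E1 E2 E0 :
  usd_frame g1 g2 L1 L2 E1 E2 E0 -> E1 *m L1 = E1.
Proof.
move=> fr; have dE1 := psd_dag (frame_E1 fr).
by rewrite -{1}dE1 -(frame_dag1 fr) -dagM (frame_sub1 fr).
Qed.

(** [F] is the inconclusive effect behind the block, while [E1] may belong to another measurement:
    both the candidate and its competitor are treated. *)
Lemma tr_dual_block Z g1 g2 L1 L2 E1 E2 E0 F :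
  usd_frame g1 g2 L1 L2 E1 E2 E0 -> L1 *m Z *m L1 = dual_block g1 g2 L1 F ->
  \tr (E1 *m Z) = \tr (E1 *m g1) + \tr (E1 *m (L1 *m gap g1 g2 F *m L1)).
Proof.
move=> fr LZ; have trL X : \tr (E1 *m (L1 *m X *m L1)) = \tr (E1 *m X).
  by rewrite mulmxA mxtrace_mulC !mulmxA (frame_sub1 fr) (frame_mulr1 fr).
by rewrite -trL LZ /dual_block !trL -mxtraceD -mulmxDr.
Qed.

(** Weak duality against the trace of [Z]: the gap terms are nonnegative for the competitor and
    vanish for the candidate. *)
Lemma gap_optimal_max g1 g2 L1 L2 E1 E2 E0 F1 F2 F0 :
  usd_frame g1 g2 L1 L2 E1 E2 E0 -> gap_optimal g1 g2 L1 L2 E1 E2 E0 ->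
  usd_frame g1 g2 L1 L2 F1 F2 F0 ->
  success_prob g1 g2 F1 F2 <= success_prob g1 g2 E1 E2.
Proof.
move=> fr opt frF; have frV := frameC fr; have optV := gap_optimalC fr opt.
have frFV := frameC frF.
have [Z [Q1 [Q2 [ZE Z1E Z2E [[dQ1 L1Q pQ1] [dQ2 L2Q pQ2 Q21]]]]]] :=
  dual_solution fr opt.
have trE : success_prob g1 g2 E1 E2 = \tr (E1 *m Z) + \tr (E2 *m Z).
  rewrite (tr_dual_block fr Z1E) (tr_dual_block frV Z2E).
  rewrite [X in _ + X + _]mxtrace_mulC [X in _ + (_ + X)]mxtrace_mulC.
  rewrite -!(mulmxA _ _ E1) -!(mulmxA _ _ E2) (frame_sub1 fr) (frame_sub2 fr).
  by rewrite (gap_conclusive fr opt) (gap_conclusive frV optV) mxtrace0 !addr0.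
have trF : success_prob g1 g2 F1 F2 <= \tr (F1 *m Z) + \tr (F2 *m Z).
  rewrite (tr_dual_block frF Z1E) (tr_dual_block frFV Z2E).
  case: opt => _ pM1 _ _ _; case: optV => _ pM2 _ _ _.
  by apply: lerD; rewrite lerDl psd_tr_ge0 //; case: frF.
have trF0 : 0 <= \tr (F0 *m Z).
  apply: (tr_dual_ge0 _ dQ1 dQ2) => //; first exact: frame_E0 frF.
  (* [1 - Q1] kills [F1] and [1 - Q2] kills [F2], so only the product of the two orthogonal
     complements remains. *)
  have F1Q : F1 *m (1%:M - Q1) = 0.
    by rewrite -(frame_mulr1 frF) -mulmxA mulmxBr mulmx1 L1Q subrr mulmx0.
  have QF2 : (1%:M - Q2) *m F2 = 0.
    rewrite -(frame_sub2 frF) mulmxA -(frame_dag2 fr) mulmxBl mul1mx -dQ2.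
    by rewrite -dagM L2Q subrr mul0mx.
  rewrite (frame_inc frF) -mulmxA (mulmxBl _ F2) (mulmxBl _ F1) F1Q mul1mx subr0.
  rewrite -[X in _ *m (X - _)]mul1mx -mulmxBl mulmxA (mulmxBr _ _ F2) QF2.
  by rewrite subr0 mulmx1.
have -> : success_prob g1 g2 E1 E2 =
    \tr (F1 *m Z) + \tr (F2 *m Z) + \tr (F0 *m Z).
  rewrite trE -!mxtraceD -!mulmxDl (frame_sum frF) -(frame_sum fr).
  by rewrite [in RHS]mulmxDl [in RHS]mxtraceD (mxtrace_mulC E0) ZE mxtrace0 addr0.
by apply: le_trans trF _; rewrite lerDl.
Qed.

End Sufficiency.

(** * Back to kernels and supports *)

Section Characterization.
Context {C : numClosedFieldType} {n : nat}.
Implicit Types g E L N : 'M[C]_n.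

(* The vectors killed by L2 are mapped by L1 onto the whole range of L1. *)
Lemma frame_section g1 g2 L1 L2 E1 E2 E0 : usd_frame g1 g2 L1 L2 E1 E2 E0 ->
  exists Y : 'M[C]_n, L1 = Y *m ((1%:M - L2) *m L1).
Proof.
move=> fr; suff /submxP[Y defY] : (L1 <= (1%:M - L2) *m L1)%MS by exists Y.
rewrite submxE; set c := cokermx _.
have /eqP : (1%:M - L2) *m L1 *m c = 0 by apply: mulmx_coker.
by rewrite -mulmxA mulmxBl mul1mx subr_eq0 => /eqP/(frame_indep fr)/eqP.
Qed.

(** Congruence by [Y (1 - L2)] kills [L2] on both sides and restores [L1]. *)
Lemma frame_psd_block g1 g2 L1 L2 E1 E2 E0 N : usd_frame g1 g2 L1 L2 E1 E2 E0 ->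
  psdmx ((L1 - L2) *m N *m (L1 + L2)) -> psdmx (L1 *m N *m L1).
Proof.
move=> fr pN; have [Y defY] := frame_section fr.
have dL1 := frame_dag1 fr; have dL2 := frame_dag2 fr.
have := psd_congrV (Y *m (1%:M - L2)) pN; congr psdmx.
have L20 : (1%:M - L2) *m L2 = 0.
  by rewrite mulmxBl mul1mx (frame_idem2 fr) subrr.
have YL : Y *m (1%:M - L2) *m (L1 - L2) = L1.
  by rewrite -mulmxA mulmxBr L20 subr0 -defY.
have LY : (L1 + L2) *m (Y *m (1%:M - L2)) ^t* = L1.
  have -> : L1 + L2 = (L1 + L2) ^t* by rewrite dagD dL1 dL2.
  rewrite -dagM -mulmxA mulmxDr L20 addr0 -defY; exact: dL1.
by rewrite !mulmxA YL -!mulmxA LY.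
Qed.

Lemma gap_optimalP g1 g2 L1 L2 E1 E2 E0 :
  usd_frame g1 g2 L1 L2 E1 E2 E0 ->
  gap_optimal g1 g2 L1 L2 E1 E2 E0 <->
  psdmx ((L1 - L2) *m gap g1 g2 E0 *m (L1 + L2)) /\
  (L1 - L2) *m gap g1 g2 E0 *m (E1 + E2) = 0.
Proof.
move=> fr; rewrite /gap_optimal /=.
have := gap_dagE fr; move: (gap g1 g2 E0) => N dN.
have dL1 := frame_dag1 fr; have dL2 := frame_dag2 fr.
have expand : (L1 - L2) *m N *m (L1 + L2) =
    L1 *m N *m L1 + L1 *m N *m L2 - (L1 *m N *m L2) ^t* - L2 *m N *m L2.
  by rewrite !dagM dL1 dL2 dN; mx_ring.
split=> [[LNL p1 p2 z1 z2]|[pN zN]].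
  split; last by rewrite 2!mulmxBl z1 z2 subr0.
  by rewrite expand LNL dag0 addr0 subr0; apply: psdD.
(* Self-adjointness makes [L1 N L2] equal to its adjoint [L2 N L1], which puts its range into both
   subspaces. *)
have LNL : L1 *m N *m L2 = 0.
  have := psd_dag pN; rewrite expand; move eqX: (L1 *m N *m L2) => X.
  have dLN K : K ^t* = K -> (K *m N *m K) ^t* = K *m N *m K.
    by move=> dK; rewrite !dagM dK dN mulmxA.
  rewrite !(dagD, dagN) !dLN // trmxCK => /addIr; rewrite -!addrA => /addrI eqXX.
  have dX : X = X ^t*.
    have : (X - X ^t*) *+ 2 = 0.
      by rewrite mulr2n -{2}eqXX addrC addrA subrK subrr.
    by move=> /eqP; rewrite -scaler_nat scaler_eq0 pnatr_eq0 /= subr_eq0 => /eqP.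
  by move: dX; rewrite -eqX !dagM dL1 dL2 dN -!mulmxA; apply: (frame_indep fr).
have z1 : L1 *m N *m (E1 + E2) = 0.
  move: zN; rewrite 2!mulmxBl => /eqP; rewrite subr_eq0 -!mulmxA => /eqP.
  exact: (frame_indep fr).
have z2 : L2 *m N *m (E1 + E2) = 0.
  by move/eqP: zN; rewrite 2!mulmxBl z1 sub0r oppr_eq0 => /eqP.
split=> //; first exact: frame_psd_block fr pN.
rewrite -mulNmx -mulmxN; apply: (frame_psd_block (frameC fr)).
by rewrite -(opprB L1 L2) (addrC L2) mulmxN !mulNmx opprK.
Qed.

End Characterization.

(** * Reduction of measurements to frames *)

Section Supports.
Context {C : numClosedFieldType} {n : nat}.
Implicit Types (g A E F X W : 'M[C]_n).

Lemma kerop_subE A X : (X ^t* <= kerop A)%MS = (A *m X == 0).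
Proof.
rewrite -{2}[X]trmxCK.
apply/sub_kermxP/eqP => [XA|AX]; last first.
  by rewrite -dagM -[X in _ *m X]trmxCK AX dag0.
by apply: dag_eq0; rewrite dagM !trmxCK.
Qed.

Lemma proj_colE W X : (X ^t* <= W)%MS -> proj_ortho W *m X = X.
Proof.
by move=> XW; rewrite -[LHS]trmxCK dagM proj_ortho_herm proj_ortho_id // trmxCK.
Qed.

Lemma suppop_proj A : psdmx A -> A *m proj_ortho (suppop A) = A.
Proof.
move=> pA; set P := proj_ortho _; have dP : P ^t* = P by apply: proj_ortho_herm.
apply/eqP; rewrite -subr_eq0 -{2}[A]mulmx1 -mulmxBr -opprB mulmxN oppr_eq0.
rewrite -kerop_subE dagD dag1 dagN dP.
rewrite -(ortho_id (kerop A)).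
by have := proj_ortho_compl_sub (suppop A) (1%:M : 'M[C]_n); rewrite mul1mx.
Qed.

Lemma suppop_proj_ker A X : A *m X = 0 -> proj_ortho (suppop A) *m X = 0.
Proof.
move=> AX; apply: dag_eq0; rewrite dagM proj_ortho_herm proj_ortho_0 //.
by rewrite (ortho_id (kerop A)) kerop_subE AX.
Qed.

Lemma usd_measurement_frame g1 g2 F1 F2 F0 :
  psdmx g1 -> psdmx g2 -> usd_measurement g1 g2 F1 F2 F0 ->
  let P := proj_ortho (supp_pair g1 g2) in
  P *m F1 = F1 -> P *m F2 = F2 ->
  usd_frame g1 g2 (proj_ortho (kerop g2 :&: supp_pair g1 g2)%MS)
    (proj_ortho (kerop g1 :&: supp_pair g1 g2)%MS) F1 F2 F0.
Proof.
move=> pg1 pg2 [pF1 pF2 pF0 sumF tr21 tr12] P PF1 PF2.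
have dP : P ^t* = P by apply: proj_ortho_herm.
have kerP g : let L := proj_ortho (kerop g :&: supp_pair g1 g2)%MS in
    g *m L = 0 /\ P *m L = L.
  move=> L; have dL : L ^t* = L by apply: proj_ortho_herm.
  split; first by apply/eqP; rewrite -kerop_subE dL proj_orthoE capmxSl.
  by apply: proj_colE; rewrite dL proj_orthoE capmxSr.
have subP g X : g *m X = 0 -> P *m X = X ->
    proj_ortho (kerop g :&: supp_pair g1 g2)%MS *m X = X.
  move=> gX PX; apply: proj_colE; rewrite sub_capmx kerop_subE gX eqxx /=.
  by rewrite -PX dagM dP proj_ortho_sub.
have g2F1 : g2 *m F1 = 0.
  apply: dag_eq0; rewrite dagM (psd_dag pg2) (psd_dag pF1).
  exact: psd_tr_mul_eq0.
have g1F2 : g1 *m F2 = 0.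
  apply: dag_eq0; rewrite dagM (psd_dag pg1) (psd_dag pF2).
  exact: psd_tr_mul_eq0.
have [gL1 PL1] := kerP g2; have [gL2 PL2] := kerP g1.
split=> //; try exact: proj_ortho_herm; try exact: proj_ortho_proj.
- exact: subP.
- exact: subP.
(* A vector in both ranges is killed by [g1 + g2], hence orthogonal to the support in which it
   lies. *)
move=> X Y eqXY; rewrite -PL1 -mulmxA; apply: suppop_proj_ker.
by rewrite mulmxDl {1}eqXY (mulmxA g1) (mulmxA g2) gL1 gL2 !mul0mx addr0.
Qed.

Lemma proper_usd_supp g1 g2 E1 E2 E0 : proper_usd g1 g2 E1 E2 E0 ->
  let P := proj_ortho (supp_pair g1 g2) in P *m E1 = E1 /\ P *m E2 = E2.
Proof.
move=> [[pE1 pE2 _ _ _ _] sub] P; have dP : P ^t* = P by apply: proj_ortho_herm.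
have EP : (E1 + E2) *m P = E1 + E2.
  rewrite -[in LHS](suppop_proj (psdD pE1 pE2)) -mulmxA proj_ortho_id.
    exact/suppop_proj/psdD.
  by rewrite proj_orthoE.
have EP0 : (E1 + E2) *m (1%:M - P) = 0 by rewrite mulmxBr mulmx1 EP subrr.
have fixP E : psdmx E -> E *m (1%:M - P) = 0 -> P *m E = E.
  rewrite mulmxBr mulmx1 => pE /eqP; rewrite subr_eq0 => /eqP EE.
  by rewrite -{1}dP -(psd_dag pE) -dagM -EE.
split; apply: fixP => //; first exact: psd_add_ker EP0.
by apply: psd_add_ker pE2 pE1 _; rewrite addrC.
Qed.

Lemma supp_pair_mulr g1 g2 (P := proj_ortho (supp_pair g1 g2)) :
  psdmx g1 -> psdmx g2 -> g1 *m P = g1 /\ g2 *m P = g2.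
Proof.
move=> pg1 pg2; have gP0 : (g1 + g2) *m (1%:M - P) = 0.
  by rewrite mulmxBr mulmx1 (suppop_proj (psdD pg1 pg2)) subrr.
have mulP g : g *m (1%:M - P) = 0 -> g *m P = g.
  by rewrite mulmxBr mulmx1 => /eqP; rewrite subr_eq0 => /eqP.
split; apply: mulP; first exact: psd_add_ker gP0.
by apply: psd_add_ker pg2 pg1 _; rewrite addrC.
Qed.

(** A competitor may fail to be proper. Its compression to the support succeeds equally often and
    fits the frame of the candidate; the complement [1 - P] goes to the inconclusive effect. *)
Lemma usd_compress g1 g2 F1 F2 F0 P :
  psdmx g1 -> psdmx g2 -> P ^t* = P -> P *m P = P ->
  g1 *m P = g1 -> g2 *m P = g2 ->
  usd_measurement g1 g2 F1 F2 F0 ->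
  usd_measurement g1 g2 (P *m F1 *m P) (P *m F2 *m P)
    (1%:M - P *m F1 *m P - P *m F2 *m P) /\
  success_prob g1 g2 (P *m F1 *m P) (P *m F2 *m P) = success_prob g1 g2 F1 F2.
Proof.
move=> pg1 pg2 dP PP g1P g2P [pF1 pF2 pF0 sumF tr21 tr12].
have trP F g : psdmx g -> g *m P = g -> \tr (P *m F *m P *m g) = \tr (F *m g).
  move=> pg gP; have Pg : P *m g = g by rewrite -{1}dP -(psd_dag pg) -dagM gP.
  by rewrite -mulmxA Pg -mulmxA mxtrace_mulC -mulmxA gP.
split; last by rewrite /success_prob !trP.
have psdP F : psdmx F -> psdmx (P *m F *m P).
  by move=> pF; rewrite -{1}dP; apply: psd_congr.
split; rewrite ?trP //; [exact: psdP | exact: psdP | | by mx_ring].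
have -> : 1%:M - P *m F1 *m P - P *m F2 *m P =
    P *m F0 *m P + (1%:M - P) ^t* *m (1%:M - P).
  rewrite (_ : F0 = 1%:M - F1 - F2); last by rewrite -sumF; mx_ring.
  have -> : (1%:M - P) ^t* *m (1%:M - P) = 1%:M - P *m P.
    by rewrite !dagE dP mulmxBl mul1mx mulmxBr mulmx1 PP subrr subr0.
  by mx_ring.
by apply: psdD; [apply: psdP | apply: psd_gram].
Qed.

End Supports.

Theorem corollary9 (R : realType) (n : nat)
    (g1 g2 : 'M[R[i]]_n) (E1 E2 Einc : 'M[R[i]]_n) :
  weighted_density g1 -> weighted_density g2 ->
  proper_usd g1 g2 E1 E2 Einc ->
  let L1 := proj_ortho (kerop g2 :&: supp_pair g1 g2)%MS in
  let L2 := proj_ortho (kerop g1 :&: supp_pair g1 g2)%MS in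
  optimal_usd g1 g2 E1 E2 Einc <->
    psdmx ((L1 - L2) *m Einc *m (g2 - g1) *m Einc *m (L1 + L2)) /\
    (L1 - L2) *m Einc *m (g2 - g1) *m Einc *m (1%:M - Einc) = 0.
Proof.
move=> pg1 pg2 proper L1 L2; have [mE _] := proper.
have [PE1 PE2] := proper_usd_supp proper.
have fr : usd_frame g1 g2 L1 L2 E1 E2 Einc by apply: usd_measurement_frame.
have -> : 1%:M - Einc = E1 + E2 by rewrite -(frame_sum fr) addrK.
have gapE X Y : X *m Einc *m (g2 - g1) *m Einc *m Y = X *m gap g1 g2 Einc *m Y.
  by rewrite /gap -!mulmxA.
rewrite !gapE -(gap_optimalP fr).
split=> [optE | opt].
  have [LML pM z1] := optimal_gap fr optE.
  have [_ pM2 z2] := optimal_gap (frameC fr) (optimal_usdC optE).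
  move: pM2 z2; rewrite (gapC g1 g2) !(mulmxN, mulNmx) (addrC E2) => pM2 /eqP.
  by rewrite oppr_eq0 => /eqP.
have PP := proj_ortho_proj (supp_pair g1 g2).
have [g1P g2P] := supp_pair_mulr pg1 pg2.
split=> // F1 F2 Finc mF.
have [mF' <-] := usd_compress pg1 pg2 (proj_ortho_herm _) PP g1P g2P mF.
apply: (gap_optimal_max fr opt (usd_measurement_frame pg1 pg2 mF' _ _)).
  by rewrite -(mulmxA _ F1) (mulmxA (proj_ortho _) (proj_ortho _)) PP.
by rewrite -(mulmxA _ F2) (mulmxA (proj_ortho _) (proj_ortho _)) PP.
Qed.
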